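(* Let $\Omega$ be a subgraph of a host graph with $\partial\Omega\neq\emptyset$, let $f:\overline{\Omega}\times\mathbb{R}\to\mathbb{R}$ and $\phi:\overline{\Omega}\to\mathbb{R}$ be given, and let $\mathcal{B}u=u$ or $\mathcal{B}u=\frac{\partial u}{\partial_\Omega n}$. Consider the problem $$-\Delta_\Omega u=f(x,u)\ \text{ in }\Omega,\qquad \mathcal{B}u=\phi(x)\ \text{ on }\partial\Omega.\quad (P)$$ Let $\overline{u}$ and $\underline{u}$ be an upper and a lower solution of (P), respectively, with $\underline{u}\le\overline{u}$ on $\overline{\Omega}$, and set $\underline{c}=\min_{\overline{\Omega}}\underline{u}$, $\overline{c}=\max_{\overline{\Omega}}\overline{u}$. Suppose there is a constant $M>0$ such that $$f(x,u)-f(x,v)\ge -M(u-v)\quad\text{for all }x\in\overline{\Omega}\text{ and all }u,v\in[\underline{c},\overline{c}]\text{ with }u\ge v.$$ Then there exist sequences $\{\underline{u}_m\}_{m\ge1}$ and $\{\overline{u}_m\}_{m\ge1}$ of functions on $\overline{\Omega}$ such that $\{\underline{u}_m\}$ is monotone nondecreasing in $m$, $\{\overline{u}_m\}$ is monotone nonincreasing in $m$, $$\underline{u}\le\underline{u}_m\le\overline{u}_m\le\overline{u}\quad\text{for all }m\ge 1,$$ and $\underline{u}_m\to\tilde{u}$, $\overline{u}_m\to\hat{u}$ as $m\to+\infty$, where $\tilde{u}$ and $\hat{u}$ are solutions of (P) that are minimal and maximal in the following sense: if $u$ is a solution of (P) satisfying $\underline{u}\le u\le\overline{u}$ on $\overline{\Omega}$,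 then $\tilde{u}\le u\le\hat{u}$ on $\overline{\Omega}$.
   Context: The host graph $G=(V,E)$ is finite, undirected and connected, with weight $\omega:V\times V\to[0,\infty)$, $\omega_{xy}=\omega_{yx}$, $\omega_{xy}=0$ iff $xy\notin E$, and measure $\mu:V\to(0,\infty)$. $\Omega$ is a connected, simple, induced subgraph (identified with its vertex set); $\partial\Omega=\{z\in V\setminus\Omega: z\sim y\text{ for some }y\in\Omega\}$ and $\overline{\Omega}=\Omega\cup\partial\Omega$. For $x\in\Omega$, $\Delta_\Omega u(x)=\sum_{y\in\overline{\Omega}}(u(y)-u(x))\frac{\omega_{yx}}{\mu(x)}$. For $z\in\partial\Omega$, $\frac{\partial u}{\partial_\Omega n}(z)=\sum_{y\in\Omega}(u(z)-u(y))\frac{\omega_{zy}}{\mu(z)}$. An upper (respectively lower) solution of (P) is a function $u:\overline{\Omega}\to\mathbb{R}$ with $-\Delta_\Omega u\ge(\le)\,f(x,u)$ in $\Omega$ and $\mathcal{B}u\ge(\le)\,\phi(x)$ on $\partial\Omega$. *)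

(* Defs.v *)
From mathcomp Require Import all_boot all_order all_algebra.
From mathcomp Require Import all_classical all_reals all_analysis.
Import Order.TTheory GRing.Theory Num.Theory.
Import numFieldNormedType.Exports.

Set Implicit Arguments.
Unset Strict Implicit.
Unset Printing Implicit Defensive.

Local Open Scope ring_scope.

(* The host graph. Loops are not excluded: simplicity is only required of the
   subgraph Omega, see [simple_in]. *)
Record weighted_graph (R : realType) (V : finType) := WeightedGraph {
  adj : rel V;
  weight : V -> V -> R;
  vmeasure : V -> R;
  adj_sym : symmetric adj;
  adj_connected : forall x y : V, connect adj x y;
  weight_ge0 : forall x y : V, 0 <= weight x y;
  weight_sym : forall x y : V, weight x y = weight y x;
  weight_eq0 : forall x y : V, weight x y = 0 <-> ~~ adj x y;
  vmeasure_gt0 : forall x : V, 0 < vmeasure x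
}.

Section Subgraph.

Variables (R : realType) (V : finType) (G : weighted_graph R V).
Variable Omega : {set V}.

Definition simple_in : Prop := forall x : V, x \in Omega -> ~~ adj G x x.

Definition connected_in : Prop :=
  forall x y : V, x \in Omega -> y \in Omega ->
    connect [rel a b | [&& a \in Omega, b \in Omega & adj G a b]] x y.

Definition boundary : {set V} :=
  [set z | (z \notin Omega) && [exists y in Omega, adj G z y]].

Definition gclosure : {set V} := Omega :|: boundary.

(* Functions on [gclosure] are represented by total functions V -> R; their
   values outside [gclosure] are never used. *)

Definition laplacian (u : V -> R) (x : V) : R :=
  \sum_(y in gclosure) (u y - u x) * (weight G y x / vmeasure G x).

Definition normal_derivative (u : V -> R) (z : V) : R :=
  \sum_(y in Omega) (u z - u y) * (weight G z y / vmeasure G z).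

Inductive boundary_condition := Dirichlet | Neumann.

Definition boundary_operator (B : boundary_condition) (u : V -> R) : V -> R :=
  match B with
  | Dirichlet => u
  | Neumann => normal_derivative u
  end.

Variables (B : boundary_condition) (f : V -> R -> R) (phi : V -> R).

Definition is_solution (u : V -> R) : Prop :=
  (forall x, x \in Omega -> - laplacian u x = f x (u x)) /\
  (forall z, z \in boundary -> boundary_operator B u z = phi z).

Definition is_upper_solution (u : V -> R) : Prop :=
  (forall x, x \in Omega -> - laplacian u x >= f x (u x)) /\
  (forall z, z \in boundary -> boundary_operator B u z >= phi z).

Definition is_lower_solution (u : V -> R) : Prop :=
  (forall x, x \in Omega -> - laplacian u x <= f x (u x)) /\
  (forall z, z \in boundary -> boundary_operator B u z <= phi z).

End Subgraph.

Definition is_min_on (R : realType) (V : finType) (A : {set V}) (u : V -> R)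
    (c : R) : Prop :=
  (exists2 x, x \in A & u x = c) /\ (forall x, x \in A -> c <= u x).

Definition is_max_on (R : realType) (V : finType) (A : {set V}) (u : V -> R)
    (c : R) : Prop :=
  (exists2 x, x \in A & u x = c) /\ (forall x, x \in A -> u x <= c).

Definition le_on (R : realType) (V : finType) (A : {set V}) (u v : V -> R)
    : Prop :=
  forall x, x \in A -> u x <= v x.

(* Main.v *)
Require Import Defs.
From mathcomp Require Import all_boot all_order all_algebra.
From mathcomp Require Import all_classical all_reals all_analysis.
From mathcomp Require Import lra.
Import Order.TTheory GRing.Theory Num.Theory.
Import numFieldNormedType.Exports.
Local Open Scope classical_set_scope.
Local Open Scope ring_scope.

(** Solutions of (P) are the fixed points of an order preserving map, so the
    Knaster-Tarski theorem supplies a least and a greatest one in the order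
    interval between the lower and the upper solution.

    The map is a damped Jacobi relaxation: at every vertex it subtracts from
    [w x] the defect of the equation required at [x], divided by a positive
    number [damping x].  Its fixed points are exactly the functions with zero
    defect, that is, the solutions of (P); it pushes a lower solution up and
    an upper solution down.  It is order preserving as soon as [damping x]
    dominates the rate at which the defect can grow with [w x]: the total
    weight around [x] accounts for the difference operators ([dsum_lipschitz],
    where the nonnegativity of the weights disposes of the neighbours), and
    the constant [M] of the one-sided Lipschitz condition for [f].  Since every
    relaxation is local, neither a linear system nor a maximum principle enters
    the argument; at a boundary vertex with the Neumann condition the total
    weight is positive because such a vertex has a neighbour in [Omega].

    Iterating such a map [T] from the lower solution does not in general lead
    to a solution, because [f] may jump upwards.  Let [Omega] consist of one
    vertex [x], joined by unit weight to one boundary vertex where [u = 0],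
    with [mu = 1].  Then (P) reads [u = f x u] at [x]; take [f x u = (u + 1) / 2]
    for [u < 1] and [f x u = 2] for [u >= 1].  The iterates of
    [w |-> (f x w + M * w) / (1 + M)] increase from the lower solution [0] to
    [1], yet [f x 1 = 2], although the value [2] at [x] gives a solution.
    The extremal solutions are therefore obtained as an infimum and a supremum
    ([least_fixpoint], [greatest_fixpoint]), and the constant sequences at
    these solutions are monotone, bounded and convergent as required. *)

(** * Fixed points of order preserving maps *)

(** Knaster-Tarski: the least fixed point is the pointwise infimum of the
    functions [w] in the order interval with [T w <= w].  Functions matter only
    through their values on [A], hence the restriction of every comparison to
    [A]. *)
Lemma least_fixpoint {R : realType} {V : finType} {A : {set V}}
    {T : (V -> R) -> V -> R} {a b : V -> R} :
    le_on A a b ->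
    (forall v w, le_on A a v -> le_on A v w -> le_on A w b ->
       le_on A (T v) (T w)) ->
    le_on A a (T a) -> le_on A (T b) b ->
  exists u, [/\ le_on A a u, le_on A u b, {in A, T u =1 u} &
    forall v, le_on A a v -> le_on A v b -> le_on A (T v) v -> le_on A u v].
Proof.
move=> ab Tmono aT Tb.
pose P w := [/\ le_on A a w, le_on A w b & le_on A (T w) w].
pose u x := inf [set r | exists2 w, P w & r = w x].
have Pb : P b by split.
have uP w : P w -> le_on A u w.
  move=> Pw x xA; apply: ge_inf; last by exists w.
  by exists (a x) => _ [v [av _ _] ->]; exact: av.
have infP v : (forall w, P w -> le_on A v w) -> le_on A v u.
  move=> vP x xA; apply: lb_le_inf; first by exists (b x), b.
  by move=> _ [w Pw ->]; exact: vP.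
have au : le_on A a u by apply: infP => w [].
have ub : le_on A u b by exact: uP.
have Tuu : le_on A (T u) u.
  apply: infP => w Pw x xA; have [_ wb Tww] := Pw.
  by rewrite (le_trans _ (Tww x xA))// Tmono//; exact: uP.
have TuP : P (T u).
  have aTu : le_on A a (T u).
    by move=> x xA; rewrite (le_trans (aT x xA))// Tmono//.
  split=> //; last exact: Tmono.
  by move=> x xA; rewrite (le_trans (Tuu x xA))// ub.
exists u; split=> // [x xA|v av vb Tv]; last exact: uP.
by apply/eqP; rewrite eq_le Tuu// uP.
Qed.

(** Negation reverses the order and turns greatest fixed points into least
    ones. *)
Lemma greatest_fixpoint {R : realType} {V : finType} {A : {set V}}
    {T : (V -> R) -> V -> R} {a b : V -> R} :
    le_on A a b ->
    (forall v w, le_on A a v -> le_on A v w -> le_on A w b ->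
       le_on A (T v) (T w)) ->
    le_on A a (T a) -> le_on A (T b) b ->
  exists u, [/\ le_on A a u, le_on A u b, {in A, T u =1 u} &
    forall v, le_on A a v -> le_on A v b -> le_on A v (T v) -> le_on A v u].
Proof.
move=> ab Tmono aT Tb.
pose opp (w : V -> R) x := - w x.
have oppK w : opp (opp w) = w by apply/funext => x; rewrite /opp opprK.
have leN v w : le_on A v w -> le_on A (opp w) (opp v).
  by move=> vw x xA; rewrite lerN2 vw.
have leNl v w : le_on A (opp v) w -> le_on A (opp w) v.
  by move=> /leN; rewrite oppK.
have leNr v w : le_on A v (opp w) -> le_on A w (opp v).
  by move=> /leN; rewrite oppK.
have [|v w bv vw wa|||u [bu ua Tu umin]] :=
    @least_fixpoint R V A (fun w => opp (T (opp w))) (opp b) (opp a).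
- exact: leN.
- by apply/leN/Tmono; [exact: leNr | exact: leN | exact: leNl].
- by rewrite oppK; exact: leN.
- by rewrite oppK; exact: leN.
exists (opp u); split=> [||x xA|v av vb vT].
- exact: leNr.
- exact: leNl.
- by rewrite /opp -[in RHS](Tu x xA) /opp opprK.
- by apply: leNr; apply: umin; rewrite ?oppK; exact: leN.
Qed.

(** * Relaxation of the boundary value problem *)

(** The total weight bounds the growth of a difference operator: raising the
    values at the other vertices only lowers its value. *)
Lemma dsum_lipschitz (R : realType) (V : finType) (S : {set V}) (k : V -> R)
    (v w : V -> R) (x : V) :
    (forall y, 0 <= k y) -> le_on S v w ->
  \sum_(y in S) (w x - w y) * k y - \sum_(y in S) (v x - v y) * k y <=
  (w x - v x) * \sum_(y in S) k y.
Proof.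
move=> k0 vw; rewrite mulr_sumr -sumrB; apply: ler_sum => y yS.
rewrite -mulrBl ler_wpM2r//.
by have := vw y yS; lra.
Qed.

Lemma laplacianN (R : realType) (V : finType) (G : weighted_graph R V)
    (Omega : {set V}) (u : V -> R) (x : V) :
  - laplacian G Omega u x =
  \sum_(y in gclosure G Omega) (u x - u y) * (weight G y x / vmeasure G x).
Proof.
by rewrite /laplacian -sumrN; apply: eq_bigr => y _; rewrite -mulNr opprB.
Qed.

Section Relaxation.

Set Implicit Arguments.
Unset Strict Implicit.

Variables (R : realType) (V : finType) (G : weighted_graph R V).
Variables (Omega : {set V}) (B : boundary_condition).
Variables (f : V -> R -> R) (phi : V -> R) (M : R).

Let A := gclosure G Omega.

Definition defect (w : V -> R) (x : V) : R :=
  if x \in Omega then - laplacian G Omega w x - f x (w x)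
  else boundary_operator G Omega B w x - phi x.

Definition damping (x : V) : R :=
  if x \in Omega then \sum_(y in A) weight G y x / vmeasure G x + M
  else match B with
       | Dirichlet => 1
       | Neumann => \sum_(y in Omega) weight G x y / vmeasure G x
       end.

Definition relax (w : V -> R) (x : V) : R := w x - defect w x / damping x.

Lemma rate_ge0 (x y z : V) : 0 <= weight G x y / vmeasure G z.
Proof. by rewrite divr_ge0 ?weight_ge0// ltW// vmeasure_gt0. Qed.

Lemma damping_gt0 (x : V) : 0 < M -> x \in A -> 0 < damping x.
Proof.
move=> M0; rewrite /damping !inE; case: ifPn => [xO _|xO /= /existsP[y]].
  by rewrite ltr_wpDl// sumr_ge0// => y _; exact: rate_ge0.
move=> /andP[yO xy]; case: B => //.
rewrite (bigD1 y)//= ltr_pwDl//; last first.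
  by apply: sumr_ge0 => z _; exact: rate_ge0.
rewrite divr_gt0 ?vmeasure_gt0// lt_def weight_ge0 andbT.
by apply/eqP => /weight_eq0; rewrite xy.
Qed.

Lemma in_gclosure (x : V) :
  (x \in A) = (x \in Omega) || (x \in boundary G Omega).
Proof. by rewrite finset.in_setU. Qed.

Lemma boundary_notin (x : V) : x \in boundary G Omega -> x \notin Omega.
Proof. by rewrite inE => /andP[]. Qed.

Lemma solution_defect (u : V -> R) :
  is_solution G Omega B f phi u <-> {in A, forall x, defect u x = 0}.
Proof.
split=> [[uO ub] x|u0].
  rewrite in_gclosure /defect; case: ifPn => [xO _|_ /= xb].
    by rewrite uO// subrr.
  by rewrite ub// subrr.
split=> x xO.
  by have := u0 x; rewrite in_gclosure /defect xO => /(_ isT)/eqP;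
    rewrite subr_eq0 => /eqP.
have := u0 x; rewrite in_gclosure xO orbT /defect.
by rewrite (negbTE (boundary_notin xO)) => /(_ isT)/eqP;
  rewrite subr_eq0 => /eqP.
Qed.

Lemma upper_solution_defect (u : V -> R) (x : V) :
  is_upper_solution G Omega B f phi u -> x \in A -> 0 <= defect u x.
Proof.
move=> [uO ub]; rewrite in_gclosure /defect.
by case: ifPn => [xO _|_ /= xb]; rewrite subr_ge0; [exact: uO|exact: ub].
Qed.

Lemma lower_solution_defect (u : V -> R) (x : V) :
  is_lower_solution G Omega B f phi u -> x \in A -> defect u x <= 0.
Proof.
move=> [uO ub]; rewrite in_gclosure /defect.
by case: ifPn => [xO _|_ /= xb]; rewrite subr_le0; [exact: uO|exact: ub].
Qed.

Hypothesis M_gt0 : 0 < M.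

Lemma solution_fixpoint (u : V -> R) :
  is_solution G Omega B f phi u <-> {in A, relax u =1 u}.
Proof.
rewrite solution_defect; split=> uA x xA.
  by rewrite /relax uA// mul0r subr0.
move: (uA x xA) => /eqP; rewrite /relax subr_eq addrC -subr_eq subrr eq_sym.
by rewrite mulf_eq0 invr_eq0 (gt_eqF (damping_gt0 M_gt0 xA)) orbF => /eqP.
Qed.

Lemma relax_upper (u : V -> R) :
  is_upper_solution G Omega B f phi u -> le_on A (relax u) u.
Proof.
move=> uu x xA; rewrite /relax gerBl divr_ge0 ?upper_solution_defect//.
exact/ltW/damping_gt0.
Qed.

Lemma relax_lower (u : V -> R) :
  is_lower_solution G Omega B f phi u -> le_on A u (relax u).
Proof.
move=> ul x xA; rewrite /relax lerDl oppr_ge0 pmulr_lle0.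
  exact: lower_solution_defect.
by rewrite invr_gt0 damping_gt0.
Qed.

(** The damping is chosen to make this hold: the defect at [x] grows by at most
    [damping x * (w x - v x)] from [v] to [w]. *)
Lemma relax_mono (v w : V -> R) :
    (forall x, x \in A -> f x (w x) - f x (v x) >= - M * (w x - v x)) ->
    le_on A v w ->
  le_on A (relax v) (relax w).
Proof.
move=> fM vw x xA; have d0 := damping_gt0 M_gt0 xA.
suff dle : defect w x - defect v x <= (w x - v x) * damping x.
  move: dle; rewrite -ler_pdivrMr// mulrBl /relax; lra.
rewrite /defect /damping; case: ifPn => [xO|xO].
  rewrite !laplacianN mulrDr.
  have := fM x xA.
  have := @dsum_lipschitz _ _ A (fun y => weight G y x / vmeasure G x) v w x
    (fun y => rate_ge0 y x x) vw.
  rewrite -/A; lra.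
case: B => /=; first by lra.
rewrite /normal_derivative.
have vwO : le_on Omega v w.
  by move=> y yO; apply: vw; rewrite in_gclosure yO.
have := @dsum_lipschitz _ _ Omega (fun y => weight G x y / vmeasure G x) v w x
  (fun y => rate_ge0 x y x) vwO.
lra.
Qed.

End Relaxation.

(** * Extremal solutions *)

Theorem theorem4p5 (R : realType) (V : finType) (G : weighted_graph R V)
  (Omega : {set V})
  (Omega_simple : simple_in G Omega)
  (Omega_connected : connected_in G Omega)
  (boundary_nonempty : boundary G Omega != finset.set0)
  (f : V -> R -> R) (phi : V -> R) (B : boundary_condition)
  (uup ulow : V -> R)
  (uup_upper : is_upper_solution G Omega B f phi uup)
  (ulow_lower : is_lower_solution G Omega B f phi ulow)
  (ulow_le_uup : le_on (gclosure G Omega) ulow uup)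
  (clow cup : R)
  (clowP : is_min_on (gclosure G Omega) ulow clow)
  (cupP : is_max_on (gclosure G Omega) uup cup)
  (M : R) (M_gt0 : 0 < M)
  (f_one_sided : forall (x : V) (u v : R), x \in gclosure G Omega ->
     clow <= u <= cup -> clow <= v <= cup -> v <= u ->
     f x u - f x v >= - M * (u - v)) :
  exists (useq_low useq_up : nat -> V -> R) (utilde uhat : V -> R),
    (forall m n : nat, (1 <= m <= n)%N ->
       le_on (gclosure G Omega) (useq_low m) (useq_low n)) /\
    (forall m n : nat, (1 <= m <= n)%N ->
       le_on (gclosure G Omega) (useq_up n) (useq_up m)) /\
    (forall m : nat, (1 <= m)%N ->
       [/\ le_on (gclosure G Omega) ulow (useq_low m),
           le_on (gclosure G Omega) (useq_low m) (useq_up m) &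
           le_on (gclosure G Omega) (useq_up m) uup]) /\
    (forall x : V, x \in gclosure G Omega ->
       (fun m => useq_low m x) @ \oo --> utilde x) /\
    (forall x : V, x \in gclosure G Omega ->
       (fun m => useq_up m x) @ \oo --> uhat x) /\
    is_solution G Omega B f phi utilde /\
    is_solution G Omega B f phi uhat /\
    (forall u : V -> R, is_solution G Omega B f phi u ->
       le_on (gclosure G Omega) ulow u -> le_on (gclosure G Omega) u uup ->
       le_on (gclosure G Omega) utilde u /\ le_on (gclosure G Omega) u uhat).
Proof.
have relaxM v w : le_on (gclosure G Omega) ulow v ->
    le_on (gclosure G Omega) v w -> le_on (gclosure G Omega) w uup ->
    le_on (gclosure G Omega)
      (relax G Omega B f phi M v) (relax G Omega B f phi M w).
  move=> lv vw wu; apply: relax_mono => // x xA.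
  have := clowP.2 x xA; have := cupP.2 x xA.
  have := lv x xA; have := vw x xA; have := wu x xA => *.
  by apply: f_one_sided => //; apply/andP; split; lra.
have lowT := relax_lower M_gt0 ulow_lower.
have upT := relax_upper M_gt0 uup_upper.
have [ut [lut utu utfix utmin]] := least_fixpoint ulow_le_uup relaxM lowT upT.
have [uh [luh uhu uhfix uhmax]] :=
  greatest_fixpoint ulow_le_uup relaxM lowT upT.
exists (fun=> ut), (fun=> uh), ut, uh.
have le_refl u : le_on (gclosure G Omega) u u by [].
split; first by [].
split; first by [].
split.
  move=> m _; split=> //; apply: utmin => // x xA.
  by rewrite uhfix.
split; first by move=> x _; exact: cvg_cst.
split; first by move=> x _; exact: cvg_cst.
split; first exact/(solution_fixpoint G Omega B f phi M_gt0).
split; first exact/(solution_fixpoint G Omega B f phi M_gt0).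
move=> u /(solution_fixpoint G Omega B f phi M_gt0) ufix lu uu.
by split; [apply: utmin|apply: uhmax] => // x xA; rewrite ufix.
Qed.
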